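(* Let $X$ be a topological space. If $\alpha\subseteq\kappa(X)$ is self-splittable, then translations are continuous for $C_\alpha(X,\mathbb{R})$; that is, for every $f_0\in C(X,\mathbb{R})$ the map $g\mapsto f_0+g$ from $C_\alpha(X,\mathbb{R})$ to itself is continuous.
   Context: Let $\mathcal{O}_X$ be the set of open subsets of $X$. For a family $\mathcal{A}$ of subsets of $X$, $\mathcal{O}_X(\mathcal{A})$ is the family of open subsets of $X$ containing an element of $\mathcal{A}$. A compact family on $X$ is a nonempty $\mathcal{A}\subseteq\mathcal{O}_X$ with $\mathcal{O}_X(\mathcal{A})=\mathcal{A}$ such that whenever $\mathcal{P}\subseteq\mathcal{O}_X$ and $\bigcup\mathcal{P}\in\mathcal{A}$, there is a finite $\mathcal{P}_0\subseteq\mathcal{P}$ with $\bigcup\mathcal{P}_0\in\mathcal{A}$ (the family $\mathcal{O}_X$ itself is allowed). $\kappa(X)$ is the set of all compact families on $X$. For a collection $\alpha\subseteq\kappa(X)$ such that every open subset of $X$ belongs to some member of $\alpha$ (a standing assumption on collections used to define function space topologies), $C_\alpha(X,\mathbb{R})$ is the set $C(X,\mathbb{R})$ of continuous functions $X\to\mathbb{R}$ with the topology having as subbase of open sets the sets $[\mathcal{A},U]=\{f: f^{-1}(U)\in\mathcal{A}\}$, for $\mathcal{A}\in\alpha$ and $U\subseteq\mathbb{R}$ open. For $\mathcal{A}\in\kappa(X)$ and $A\in\mathcal{A}$, $\mathcal{A}\downarrow A=\{U\in\mathcal{O}_X:\exists B\in\mathcal{A},\ B\subseteq A\cap U\}$.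 A collection $\alpha\subseteq\kappa(X)$ is self-splittable if for every $\mathcal{A}\in\alpha$ and all open $U_1,U_2\subseteq X$ with $U_1\cup U_2\in\mathcal{A}$ there exist $\mathcal{G}_1,\mathcal{G}_2\in\alpha$ with $U_i\in\mathcal{G}_i$ and $\mathcal{G}_i=\mathcal{G}_i\downarrow U_i$ for $i\in\{1,2\}$, such that $\mathcal{G}_1\cap\mathcal{G}_2\subseteq\mathcal{A}$. *)

(* Defs.v *)
From HB Require Import structures.
From mathcomp Require Import all_boot all_order all_algebra.
From mathcomp Require Import all_classical all_reals all_analysis.
Import Order.TTheory GRing.Theory Num.Theory.
Import numFieldNormedType.Exports.

Set Implicit Arguments.
Unset Strict Implicit.
Unset Printing Implicit Defensive.

Local Open Scope classical_set_scope.
Local Open Scope ring_scope.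

Section Families.
Context {X : topologicalType}.
Implicit Types (A : set (set X)) (alpha : set (set (set X))).

Definition open_supersets A : set (set X) :=
  [set U | open U /\ exists2 B, A B & B `<=` U].

Definition compact_family A : Prop :=
  [/\ A !=set0, A `<=` open, open_supersets A = A &
      forall P : set (set X), P `<=` open -> A (\bigcup_(U in P) U) ->
        exists P0 : set (set X),
          [/\ finite_set P0, P0 `<=` P & A (\bigcup_(U in P0) U)]].

(* $\mathcal{A}\downarrow V$; meant for $V\in\mathcal{A}$, but total in V. *)
Definition down A (V : set X) : set (set X) :=
  [set U | open U /\ exists2 B, A B & B `<=` V `&` U].

Definition self_splittable alpha : Prop :=
  forall A, alpha A ->
  forall U1 U2 : set X, open U1 -> open U2 -> A (U1 `|` U2) ->
  exists G1 G2 : set (set X),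
    [/\ alpha G1 /\ alpha G2,
        G1 U1 /\ G2 U2,
        G1 = down G1 U1 /\ G2 = down G2 U2 &
        G1 `&` G2 `<=` A].

Definition covers_opens alpha : Prop :=
  forall U : set X, open U -> exists2 A, alpha A & A U.

End Families.

(* The set of all compact families on X. *)
Definition kappa (X : topologicalType) : set (set (set X)) :=
  [set A | compact_family A].
Arguments kappa : clear implicits.

(* $C_\alpha(X,Y)$: an alias of the type of continuous functions, so that each
   alpha carries its own topology. *)
Definition Calpha (X Y : topologicalType) (alpha : set (set (set X))) : Type :=
  continuousType X Y.

Section CalphaTopology.
Context {X Y : topologicalType} (alpha : set (set (set X))).

HB.instance Definition _ := Choice.on (Calpha Y alpha).

Definition bracket (A : set (set X)) (U : set Y) : set (Calpha Y alpha) :=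
  [set f : continuousType X Y | A (f @^-1` U)].

(* The topology having as subbase of open sets the [A, U] with A in alpha and U
   open; a subbasic set is indexed by the pair (A, U). *)
HB.instance Definition _ :=
  @isSubBaseTopological.Build (Calpha Y alpha)
    (set (set X) * set Y)%type
    [set p | alpha p.1 /\ open p.2]
    (fun p => bracket p.1 p.2).

End CalphaTopology.

Section Translation.
Context {X : topologicalType} {R : realType}.

Lemma cts_add_subproof (f g : continuousType X R) :
  continuous (fun x => f x + g x).
Proof. by move=> x; apply: continuousD; exact: cts_fun. Qed.

Definition cts_add (f g : continuousType X R) : continuousType X R :=
  mkcts (@cts_add_subproof f g).

Definition translation (alpha : set (set (set X))) (f0 : continuousType X R)
  (g : Calpha R alpha) : Calpha R alpha := cts_add f0 g.

End Translation.

(* Main.v *)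
Require Import Defs.
From mathcomp Require Import all_boot all_order all_algebra.
From mathcomp Require Import all_classical all_reals all_analysis.
Import numFieldNormedType.Exports.

Local Open Scope classical_set_scope.

(** Fix [f0], [g0], a family [A] in [alpha] and an open [U] such that
    [W = (f0 + g0)^-1(U)] belongs to [A]. Since addition is continuous, [W] is
    the union of the open sets [f0^-1(N) `&` g0^-1(V)], where [N] and [V] are
    open and [N + V] is included in [U]. By compactness of [A], a finite union
    of such sets [W_i = f0^-1(N_i) `&` g0^-1(V_i)] already belongs to [A].

    Iterating self-splittability along this finite union yields families [G_i]
    in [alpha] with [W_i] in [G_i] and [G_i = down G_i W_i], whose common
    members all belong to [A]. Then [g0] is in each [bracket G_i V_i]. If [g]
    is in [bracket G_i V_i], some member of [G_i] is included in
    [W_i `&` g^-1(V_i)], hence in [f0^-1(N_i) `&` g^-1(V_i)] and in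
    [(f0 + g)^-1(U)]; so the latter belongs to [G_i]. If [g] is in all these
    neighborhoods of [g0], then [(f0 + g)^-1(U)] belongs to every [G_i],
    therefore to [A].

    The iteration is [self_splittable_bigcup]. It is stated for a filter [F] on
    the subsets of [X] instead of the intersection of the [G_i], which spares
    naming the [G_i]; the filter used is the image of the neighborhoods of [g0] by
    [g |-> (f0 + g)^-1(U)]. *)

Lemma compact_familyS {X : topologicalType} {A : set (set X)} {B U : set X} :
  compact_family A -> A B -> open U -> B `<=` U -> A U.
Proof. by move=> [_ _ AE _] AB oU BU; rewrite -AE; split => //; exists B. Qed.

(** Iterated splitting. Let [F] be a filter on the subsets of [X] containing the
    collection of open sets. If [F] contains every [G] in [alpha] such that
    [G = down G W] for some [W] in [P] and in [G], then it contains every family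
    of [alpha] to which the union of the finite collection [P] belongs. *)
Lemma self_splittable_bigcup {X : topologicalType} {alpha : set (set (set X))}
    {F : set_system (set X)} {P : set (set X)} :
  alpha `<=` kappa X -> self_splittable alpha -> Filter F -> F open ->
  finite_set P -> P `<=` open ->
  (forall W G, P W -> alpha G -> G W -> G = Defs.down G W -> F G) ->
  forall A, alpha A -> A (\bigcup_(W in P) W) -> F A.
Proof.
move=> kalpha split_alpha FF Fopen /finite_seqP[s ->]{P}.
elim: s => [|W s IHs] os FG A alphaA.
  (* If the empty set is in [A], then so are all open sets. *)
  rewrite set_nil bigcup_set0 => A0.
  apply: filterS Fopen => V oV.
  exact: compact_familyS (kalpha _ alphaA) A0 oV (@sub0set _ _).
have oW : open W by apply: os; rewrite /= mem_head.
have os' : [set` s] `<=` open.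
  by move=> V sV; apply: os; rewrite /= in_cons sV orbT.
rewrite bigcup_seq big_cons -bigcup_seq => AWs.
have [G1 [G2 [[aG1 aG2] [G1W G2s] [G1down _] GA]]] :=
  split_alpha _ alphaA _ _ oW (bigcup_open os') AWs.
apply: filterS GA _; apply: filterI.
  by apply: (FG W) => //=; rewrite mem_head.
apply: IHs G2s => // V G sV; apply: FG.
by rewrite /= in_cons sV orbT.
Qed.

Lemma bracket_open {X Y : topologicalType} {alpha : set (set (set X))}
    {A : set (set X)} {U : set Y} :
  alpha A -> open U -> open (bracket A U : set (Calpha Y alpha)).
Proof.
move=> aA oU; exists [set bracket A U]; last by rewrite bigcup_set1.
by move=> _ ->; exact: (finI_from1 _ (i := (A, U))).
Qed.

(** Convergence in [Calpha] may be tested on the subbase. *)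
Lemma cvg_bracket {X Y : topologicalType} {alpha : set (set (set X))}
    {F : set_system (Calpha Y alpha)} {f : Calpha Y alpha} :
  Filter F ->
  (forall A U, alpha A -> open U -> bracket A U f -> F (bracket A U)) ->
  F --> f.
Proof.
move=> FF Fbracket B; rewrite nbhsE => -[_ [[D Dfin <-] [I DI If]] DB].
apply: filterS (subset_trans (bigcup_sup DI) DB) _.
have [K sK eK] := Dfin _ DI.
rewrite -eK in If *.
apply: filter_bigI => -[A U] KAU; have /set_mem[aA oU] := sK _ KAU.
by apply: Fbracket => //; exact: (If _ KAU).
Qed.

Theorem proposition4p2 (R : realType) (X : topologicalType)
    (alpha : set (set (set X))) :
  alpha `<=` kappa X ->
  covers_opens alpha ->
  self_splittable alpha ->
  forall f0 : continuousType X R,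
    continuous (translation f0 : Calpha R alpha -> Calpha R alpha).
Proof.
move=> kalpha _ split_alpha f0 g0.
have FF : Filter (nbhs g0) := nbhs_filter (g0 : Calpha R alpha).
apply: cvg_bracket => A U alphaA oU AW.
(* The sets [W_i] are taken from [P]; passing to [h @ g0] turns the goal into
   membership of [A] in a filter on the subsets of [X]. *)
pose h (g : Calpha R alpha) : set X :=
  (translation f0 g : Calpha R alpha) @^-1` U.
have oh g : open (h g) by apply: open_comp => // x _; exact: cts_fun.
pose P : set (set X) := [set W | exists N V : set R, [/\ open N, open V,
  forall a b, N a -> V b -> U (a + b)%R &
  W = f0 @^-1` N `&` (g0 : continuousType X R) @^-1` V]].
have Popen : P `<=` open.
  move=> _ [N [V [oN oV _ ->]]].
  by apply: openI; apply: open_comp => // x _; exact: cts_fun.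
have hP : h g0 = \bigcup_(W in P) W.
  apply/seteqP; split => [x Ux|x [_ [N [V [_ _ NV ->]]] [Nx Vx]]]; last first.
    exact: NV.
  have [[N V] /= [nN nV] NVU] :=
    @add_continuous R (f0 x, (g0 : continuousType X R) x) U
      (open_nbhs_nbhs (conj oU Ux)).
  exists (f0 @^-1` N° `&` (g0 : continuousType X R) @^-1` V°); last by split.
  exists N°, V°; split => //; try exact: open_interior.
  by move=> a b /interior_subset Na /interior_subset Vb; exact: (NVU (a, b)).
have [_ _ _ cptA] := kalpha _ alphaA.
have [P0 [finP0 P0P AP0]] : exists P0 : set (set X),
    [/\ finite_set P0, P0 `<=` P & A (\bigcup_(W in P0) W)].
  by apply: cptA => //; rewrite -hP.
have P0open := subset_trans P0P Popen.
change ((h @ g0) A).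
apply: (self_splittable_bigcup kalpha split_alpha) AP0 => //.
  exact: (@filterE _ (nbhs g0) FF _ oh).
move=> _ G /P0P[N [V [oN oV NVU ->]]] alphaG GW Gdown.
have compG := kalpha _ alphaG.
(* [bracket G V] is the neighborhood of [g0] on which [h g] belongs to [G]. *)
have nG : nbhs g0 (bracket G V : set (Calpha R alpha)).
  apply: open_nbhs_nbhs; split; first exact: bracket_open.
  apply: compact_familyS compG GW _ _; last by move=> x [].
  by apply: open_comp => // x _; exact: cts_fun.
apply: filterS nG => g; rewrite /bracket /= Gdown => -[_ [B GB Bsub]].
split => //; exists B => // x Bx.
have [[Nx Wx] gVx] := Bsub x Bx.
by split; [split|exact: NVU].
Qed.
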